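(* Let $k \ge 3$, let $0 \le v < \lvert I_{k-2}\rvert$, and let $0 \le u \le 2^{k-1}-b_k$ be integers. Then $$M(a_k+v)=M(2^{k-2}-(a_{k-2}+v))+M(a_{k-2}+v),$$ $$M(b_k+u)=M(2^{k-1}-(a_{k-1}+u)),$$ $$M(2^k-(b_k+u))=M(2^{k-1}-(a_{k-1}+u)),$$ $$M(c_k+v)=M(a_{k-2}+v).$$
   Context: A BSD representation of an integer $n$ is a digit string $(b_{m-1}\cdots b_0)$ with $b_j\in\{1,0,-1\}$ and $n=\sum b_j2^j$; its Hamming weight is the number of nonzero digits. A non-adjacent form (NAF) is a BSD representation in which no two adjacent digits are both nonzero; it is reduced if its leading digit is nonzero. Every positive integer has exactly one reduced NAF; its length is the NAF-bitlength of $n$. $I_k$ denotes the set of positive integers of NAF-bitlength $k$; it is a set of consecutive integers (e.g. $I_1=\{1\}$, $I_2=\{2\}$, $I_3=\{3,4,5\}$), and for $k\ge3$, $\lvert I_k\rvert=2\lvert I_{k-2}\rvert+\lvert I_{k-1}\rvert$. For $n\in I_k$, a BSD representation of $n$ of length $k$ is optimal if it has the same Hamming weight as the reduced NAF of $n$; $M(n)$ denotes the number of optimal representations of $n$. Write $a_k=\min I_k$ for $k\ge1$ and $a_0=0$ (equivalently $a_1=1,a_2=2$, $a_k=2^{k-2}+a_{k-2}$). For $k\ge3$, $I_k$ is partitioned into consecutive subintervals $\mathcal{A}_k$ (first $\lvert I_{k-2}\rvert$ elements), $\mathcal{B}_k$ (next $\lvert I_{k-1}\rvert$ elements), $\mathcal{C}_k$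 (last $\lvert I_{k-2}\rvert$ elements), with minima $a_k$, $b_k=a_k+\lvert I_{k-2}\rvert$, $c_k=b_k+\lvert I_{k-1}\rvert=2^{k-1}+a_{k-2}$. *)

(* Defs.v *)
From HB Require Import structures.
From mathcomp Require Import all_boot all_order all_algebra.
From mathcomp Require Import zify.

Set Implicit Arguments.
Unset Strict Implicit.
Unset Printing Implicit Defensive.

Import Order.TTheory GRing.Theory Num.Theory.

Definition digit : finType := seq_sub [:: 1%R; 0%R; (-1)%R : int].

Definition dval (d : digit) : int := ssval d.

(* Digit strings are stored least significant digit first: the string         *)
(* (b_{m-1} ... b_0) is the sequence [:: b_0; ...; b_{m-1}].                  *)
Definition bsd_value (s : seq digit) : int :=
  (\sum_(j < size s) (map dval s)`_j * 2 ^+ j)%R.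

Definition weight (s : seq digit) : nat := count (fun d => dval d != 0%R) s.

Definition nonadjacent (s : seq digit) : bool :=
  sorted (fun d e => (dval d == 0%R) || (dval e == 0%R)) s.

(* The leading digit is the last item; the default value 1 makes the empty    *)
(* string reduced, so that it is the reduced NAF of 0.                        *)
Definition reduced (s : seq digit) : bool := last 1%R (map dval s) != 0%R.

Definition is_reduced_naf (n : int) (s : seq digit) : bool :=
  [&& nonadjacent s, reduced s & bsd_value s == n].

Definition digit_one : digit := @SeqSub int [:: 1%R; 0%R; (-1)%R] 1%R isT.
Definition digit_zero : digit := @SeqSub int [:: 1%R; 0%R; (-1)%R] 0%R isT.
Definition digit_mone : digit := @SeqSub int [:: 1%R; 0%R; (-1)%R] (-1)%R isT.

Lemma dvalP (d : digit) : [\/ dval d = 1%R, dval d = 0%R | dval d = (-1)%R].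
Proof.
case: d => x px; rewrite /dval /=; move: px.
by rewrite !inE => /or3P[] /eqP ->; [apply: Or31 | apply: Or32 | apply: Or33].
Qed.

Lemma dval_inj : injective dval. Proof. exact: val_inj. Qed.

Lemma bsd_value_nil : bsd_value [::] = 0%R.
Proof. by rewrite /bsd_value big_ord0. Qed.

Lemma bsd_value_cons d s :
  bsd_value (d :: s) = (dval d + 2 * bsd_value s)%R.
Proof.
rewrite /bsd_value /= big_ord_recl /= mulr1 mulr_sumr; congr (_ + _)%R.
by apply: eq_bigr => i _; rewrite /bump /= add1n exprS mulrCA.
Qed.

Lemma bsd_value_lt s : (bsd_value s < 2 ^+ size s)%R.
Proof.
elim: s => [|d s IHs]; first by rewrite bsd_value_nil.
rewrite bsd_value_cons /= exprS; move: IHs.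
set x := bsd_value s; set y := (2 ^+ size s)%R.
by case: (dvalP d) => ->; lia.
Qed.

Lemma reduced_behead d s : reduced (d :: s) -> reduced s.
Proof. by case: s. Qed.

Lemma nonadjacent_behead d s : nonadjacent (d :: s) -> nonadjacent s.
Proof. exact: path_sorted. Qed.

Lemma reduced_naf_0 s :
  nonadjacent s -> reduced s -> bsd_value s = 0%R -> s = [::].
Proof.
elim: s => // d s IHs ns rs; rewrite bsd_value_cons => v0.
have sE : s = [::].
  apply: IHs; [exact: nonadjacent_behead ns | exact: reduced_behead rs |].
  by move: v0; case: (dvalP d) => ->; lia.
subst s; move: rs v0; rewrite /reduced /= bsd_value_nil mulr0 addr0.
by move=> /eqP.
Qed.

Lemma nonadjacent_even d s : nonadjacent (d :: s) -> dval d <> 0%R ->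
  exists x, bsd_value s = (2 * x)%R.
Proof.
case: s => [|e s] /=; first by exists 0%R; rewrite bsd_value_nil mulr0.
case/andP=> /orP[/eqP-> //|/eqP e0] _ _; exists (bsd_value s).
by rewrite bsd_value_cons e0 add0r.
Qed.

Lemma reduced_naf_unique s t : nonadjacent s -> reduced s ->
  nonadjacent t -> reduced t -> bsd_value s = bsd_value t -> s = t.
Proof.
elim: s t => [|d s IHs] [|e t] // ns rs nt rt.
- by rewrite bsd_value_nil => /esym v0; rewrite (reduced_naf_0 nt rt v0).
- by rewrite bsd_value_nil => v0; rewrite (reduced_naf_0 ns rs v0).
rewrite !bsd_value_cons => vE.
have deE : dval d = dval e.
  have := nonadjacent_even ns; have := nonadjacent_even nt; move: vE.
  case: (dvalP d) => ->; case: (dvalP e) => -> vE // evt evs; try (exfalso; lia).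
    by case: evt => // x xE; case: evs => // y yE; exfalso; lia.
  by case: evt => // x xE; case: evs => // y yE; exfalso; lia.
rewrite (dval_inj deE); congr (_ :: _); apply: IHs.
- exact: nonadjacent_behead ns.
- exact: reduced_behead rs.
- exact: nonadjacent_behead nt.
- exact: reduced_behead rt.
- by move: vE; rewrite deE; lia.
Qed.

Lemma reduced_naf_exists (n : nat) : exists s, is_reduced_naf (Posz n) s.
Proof.
elim/ltn_ind: n => n IHn.
have [->|n_gt0] := posnP n; first by exists [::]; rewrite /is_reduced_naf bsd_value_nil.
have [m [mn [nE|[d [d0 nE]]]]] : exists m : nat, m < n /\
   (Posz n = (2 * Posz m)%R \/
    exists d : digit, dval d <> 0%R /\ Posz n = (dval d + 2 * (2 * Posz m))%R).
- have : n %% 4 = 1 \/ n %% 4 = 3 \/ n %% 2 = 0 by lia.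
  case=> [nm|[nm|nm]].
  + exists (n %/ 4); split; first by lia.
    by right; exists digit_one; split=> //; rewrite /dval /=; lia.
  + exists (n %/ 4).+1; split; first by lia.
    by right; exists digit_mone; split=> //; rewrite /dval /=; lia.
  + by exists (n %/ 2); split; [lia | left; lia].
- have [s /and3P[ns rs /eqP vs]] := IHn _ mn.
  exists (digit_zero :: s); rewrite /is_reduced_naf bsd_value_cons vs nE.
  rewrite /dval /= add0r eqxx andbT; case: s ns rs vs => [|e s] ns rs vs.
    by move: vs; rewrite bsd_value_nil; lia.
  by rewrite /nonadjacent /= in ns *; rewrite ns.
have [s /and3P[ns rs /eqP vs]] := IHn _ mn.
case: s ns rs vs => [|e s] ns rs vs.
  exists [:: d]; rewrite /is_reduced_naf bsd_value_cons nE -vs.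
  rewrite bsd_value_nil !mulr0 eqxx andbT /nonadjacent /reduced /=.
  exact/eqP.
exists [:: d, digit_zero, e & s].
have -> : is_reduced_naf (Posz n) [:: d, digit_zero, e & s] =
          nonadjacent [:: d, digit_zero, e & s] && reduced (e :: s).
  rewrite /is_reduced_naf (bsd_value_cons d) (bsd_value_cons digit_zero) vs.
  by rewrite [dval digit_zero]/= add0r nE eqxx andbT.
by rewrite rs andbT; rewrite /nonadjacent /= in ns *; rewrite orbT.
Qed.

Definition naf (n : nat) : seq digit := xchoose (reduced_naf_exists n).

Definition naf_bitlength (n : nat) : nat := size (naf n).

Lemma nafP (n : nat) : is_reduced_naf (Posz n) (naf n).
Proof. exact: xchooseP. Qed.

Lemma naf_unique (n : nat) s : is_reduced_naf (Posz n) s -> naf n = s.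
Proof.
move=> /and3P[ns rs /eqP vs]; have /and3P[nn rn /eqP vn] := nafP n.
by apply: reduced_naf_unique; rewrite ?vn ?vs.
Qed.

(* The bound 2 ^ k loses no element, as mem_I_ shows.                          *)
Definition I_ (k : nat) : seq nat :=
  [seq n <- iota 0 (2 ^ k) | (0 < n) && (naf_bitlength n == k)].

Lemma mem_I_ k n : (n \in I_ k) = (0 < n) && (naf_bitlength n == k).
Proof.
rewrite mem_filter mem_iota add0n /=.
case: (boolP (_ && (_ == k))) => //= /andP[_ /eqP <-].
have /and3P[_ _ /eqP vn] := nafP n; have := bsd_value_lt (naf n).
rewrite vn -/(naf_bitlength n).
suff -> : (2 ^+ naf_bitlength n)%R = Posz (2 ^ naf_bitlength n) by rewrite ltz_nat.
by rewrite -natrX natz.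
Qed.

Lemma I_nonempty k : exists n, n \in I_ k.+1.
Proof.
exists (2 ^ k); rewrite mem_I_ expn_gt0 /= /naf_bitlength.
rewrite (@naf_unique _ (rcons (nseq k digit_zero) digit_one)).
  by rewrite size_rcons size_nseq.
rewrite /is_reduced_naf /reduced map_rcons last_rcons /=; apply/andP; split.
  by case: k => // k; elim: k => // k IHk; rewrite /nonadjacent /= in IHk *.
apply/eqP; elim: k => [|k IHk]; first by rewrite /= bsd_value_cons bsd_value_nil.
by rewrite /= bsd_value_cons IHk expnS /dval /= add0r PoszM.
Qed.

Definition a_ (k : nat) : nat :=
  if k is k'.+1 then ex_minn (I_nonempty k') else 0.

Definition b_ (k : nat) : nat := a_ k + size (I_ (k - 2)).

Definition c_ (k : nat) : nat := b_ k + size (I_ (k - 1)).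

Definition optimal (n : nat) (t : (naf_bitlength n).-tuple digit) : bool :=
  (bsd_value t == (Posz n)) && (weight t == weight (naf n)).

(* M 0 is a junk value (0 has the empty string as reduced NAF).              *)
Definition M (n : nat) : nat := #|[set t | @optimal n t]|.

(* Main.v *)
(** A nonadjacent string has minimal weight among all strings of the same value,
    and a positive integer n has NAF-bitlength k exactly when
    2^k < 3 n < 2^(k+1).  Put j = k - 2, m = a_j + v and p = 2^(k-1) - (b_k + u).
    Then m lies in I_j, 3 p < 2^j, and the four arguments on the left are
    2^j + m, 2^(j+1) - p, 2^(j+1) + p and 2^(j+1) + m, while
    2^(k-1) - (a_(k-1) + u) = 2^j + p.  Allowing strings longer than the
    NAF-bitlength of n adds to its optimal representations only leading zeros, so
    M can be computed at any sufficient length, and the identities follow by splitting on the leading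
    digits. *)

Require Import Defs.
From mathcomp Require Import all_boot all_order all_algebra.
From mathcomp Require Import zify.

Set Implicit Arguments.
Unset Strict Implicit.
Unset Printing Implicit Defensive.

Import Order.TTheory GRing.Theory Num.Theory.

(** * Concatenation and negation of digit strings *)

Lemma exprz2 j : (2 ^+ j : int)%R = Posz (2 ^ j).
Proof. by rewrite -natrX natz. Qed.

Lemma digitP (d : digit) : [\/ d = digit_one, d = digit_zero | d = digit_mone].
Proof.
by case: (dvalP d) => dE; [apply: Or31 | apply: Or32 | apply: Or33]; apply: dval_inj.
Qed.

(* Rewriting with this lemma, unlike [/=], does not unfold the type [digit]. *)
Lemma size_cons (d : digit) s : size (d :: s) = (size s).+1.
Proof. by []. Qed.

Lemma weight_cons d s : weight (d :: s) = (dval d != 0%R) + weight s.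
Proof. by []. Qed.

Lemma bsd_value_cat s t :
  bsd_value (s ++ t) = (bsd_value s + Posz (2 ^ size s) * bsd_value t)%R.
Proof.
elim: s => [|d s IHs] /=; first by rewrite bsd_value_nil add0r mul1r.
by rewrite !bsd_value_cons IHs expnS PoszM mulrDr addrA mulrA.
Qed.

Lemma bsd_value_rcons s d :
  bsd_value (rcons s d) = (bsd_value s + Posz (2 ^ size s) * dval d)%R.
Proof.
by rewrite -cats1 bsd_value_cat bsd_value_cons bsd_value_nil mulr0 addr0.
Qed.

Lemma bsd_value_nseq0 z : bsd_value (nseq z digit_zero) = 0%R.
Proof.
by elim: z => [|z IHz] /=; rewrite ?bsd_value_nil // bsd_value_cons IHz.
Qed.

Definition digit_opp (d : digit) : digit :=
  if dval d == 1%R then digit_mone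
  else if dval d == 0%R then digit_zero else digit_one.

Lemma dval_opp d : dval (digit_opp d) = (- dval d)%R.
Proof. by case: (digitP d) => ->. Qed.

Lemma digit_oppK : involutive digit_opp.
Proof. by move=> d; case: (digitP d) => ->. Qed.

Definition bsd_opp := map digit_opp.

Lemma bsd_value_opp s : bsd_value (bsd_opp s) = (- bsd_value s)%R.
Proof.
elim: s => [|d s IHs] /=; first by rewrite bsd_value_nil oppr0.
by rewrite !bsd_value_cons IHs dval_opp; lia.
Qed.

Lemma weight_opp s : weight (bsd_opp s) = weight s.
Proof.
by rewrite /weight count_map; apply: eq_count => d /=; rewrite dval_opp oppr_eq0.
Qed.

Lemma nonadjacent_opp s : nonadjacent (bsd_opp s) = nonadjacent s.
Proof.
rewrite /nonadjacent sorted_map; apply: eq_sorted => d e /=.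
by rewrite !dval_opp !oppr_eq0.
Qed.

(** * Minimal weight of nonadjacent strings *)

(** Ripple carry: meeting an equal digit, the added digit leaves 0 and is carried on, so the digit
    erased pays for the carry; at 0 or at the opposite digit it stops. *)
Lemma bsd_add_digit (d : digit) s : exists t,
  [/\ bsd_value t = (bsd_value s + dval d)%R,
      weight t <= (weight s).+1 & size t <= (size s).+1].
Proof.
elim: s d => [|e s IHs] d.
  exists [:: d]; rewrite bsd_value_cons bsd_value_nil /weight /=.
  by split=> //; [lia | case: (_ != _)].
have [d0|dn0] := eqVneq (dval d) 0%R.
  by exists (e :: s); rewrite d0; split; lia.
have [e0|en0] := eqVneq (dval e) 0%R.
  exists (d :: s); rewrite !bsd_value_cons /weight /= e0.
  by split; [lia | case: (_ != _); lia | lia].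
have [edE|edE] := eqVneq (dval e) (dval d).
  have [t [vt wt st]] := IHs d.
  exists (digit_zero :: t); rewrite !bsd_value_cons !weight_cons vt edE dn0.
  split; [|by rewrite /=; lia|by []].
  by rewrite [dval digit_zero]/=; lia.
exists (digit_zero :: s); rewrite !bsd_value_cons !weight_cons en0.
split; [|by rewrite /=; lia|by rewrite /=; lia]; rewrite [dval digit_zero]/=.
by move: dn0 en0 edE; case: (dvalP d) => ->; case: (dvalP e) => -> //; lia.
Qed.

(** Equal lowest digits are stripped. Otherwise the second digit of [s], if any, is 0 while that of
    [t] is nonzero by parity, and this surplus digit pays for a carry that equalizes the remaining
    values. *)
Lemma nonadjacent_weight_min s t : nonadjacent s ->
  bsd_value s = bsd_value t -> weight s <= weight t.
Proof.
have [n] := ubnP (size s + size t); elim: n s t => // n IHn [|d s] t // le_n ns vE.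
have ns' := nonadjacent_behead ns.
case: t le_n vE => [|e t] le_n vE.
  have sv0 : bsd_value (d :: s) = 0%R by rewrite vE bsd_value_nil.
  have [d0|dn0] := eqVneq (dval d) 0%R.
    rewrite /weight /= d0 /=; apply: (IHn _ [::]) => //.
    by move: sv0; rewrite bsd_value_cons bsd_value_nil; lia.
  move/eqP: dn0 => dn0; have [x xE] := nonadjacent_even ns dn0.
  by move: sv0; rewrite bsd_value_cons xE; case: (dvalP d) dn0 => -> //; lia.
have [deE|deN] := eqVneq d e.
  subst e; rewrite /weight /= leq_add2l; apply: IHn => //.
    by move: le_n; rewrite !size_cons; lia.
  by move: vE; rewrite !bsd_value_cons; lia.
(* The values agree modulo 2, so the differing lowest digits are opposite. *)
have [dn0 deO] : dval d <> 0%R /\ dval e = (- dval d)%R.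
  move: deN vE; rewrite !bsd_value_cons.
  by case: (digitP d) => ->; case: (digitP e) => -> // _;
     rewrite ![dval _]/=; lia.
have en0 : dval e <> 0%R by rewrite deO; lia.
have wdE : weight (d :: s) = (weight s).+1 by rewrite /weight /=; move/eqP: dn0 => ->.
have weE : weight (e :: t) = (weight t).+1 by rewrite /weight /=; move/eqP: en0 => ->.
rewrite wdE weE ltnS.
have [x xE] := nonadjacent_even ns dn0.
have vt : bsd_value t = (bsd_value s + dval d)%R.
  by move: vE; rewrite !bsd_value_cons deO; lia.
case: s ns ns' le_n vE wdE xE vt => [|c s] ns ns' le_n vE wdE xE vt; first by [].
have c0 : dval c = 0%R by move: ns => /= /andP[/orP[/eqP //|/eqP ->]].
have -> : weight (c :: s) = weight s by rewrite /weight /= c0.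
have ns'' := nonadjacent_behead ns'.
case: t le_n vE weE vt => [|f t] le_n vE weE vt.
  by move: vt; rewrite bsd_value_nil xE; case: (dvalP d) dn0 => -> //; lia.
move: vt; rewrite !bsd_value_cons c0 add0r => vt.
have fn0 : dval f <> 0%R by case: (dvalP d) dn0 vt => -> // _; lia.
have -> : weight (f :: t) = (weight t).+1 by rewrite /weight /=; move/eqP: fn0 => ->.
have [fd|fd] := eqVneq (dval f) (dval d).
  by apply/leqW/IHn => //; [move: le_n; rewrite !size_cons; lia | lia].
(* Now [f] is opposite to [d], so [t] is worth [d] more than [s]; correcting this adds at most one
   nonzero digit, which the dropped [f] pays for. *)
have [r [vr wr sr]] := bsd_add_digit (digit_opp d) t.
apply: leq_trans wr; apply: IHn => //; first by move: le_n; rewrite !size_cons; lia.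
rewrite vr dval_opp; move: vt fd.
by case: (dvalP d) dn0 => -> // _; case: (dvalP f) fn0 => -> //; lia.
Qed.

(** * Size bounds and the intervals [I_ k] *)

Lemma nonadjacent_naf n : nonadjacent (naf n).
Proof. by case/and3P: (nafP n). Qed.

Lemma bsd_value_naf n : bsd_value (naf n) = Posz n.
Proof. by case/and3P: (nafP n) => _ _ /eqP. Qed.

Lemma reduced_naf n : reduced (naf n).
Proof. by case/and3P: (nafP n). Qed.

Lemma weight_naf n s : nonadjacent s -> bsd_value s = Posz n ->
  weight (naf n) = weight s.
Proof.
move=> ns vs; apply/eqP; rewrite eqn_leq.
by rewrite !nonadjacent_weight_min ?nonadjacent_naf ?vs ?bsd_value_naf.
Qed.

(** The extreme string is 1 0 1 0 ... from the top. A low 0 is peeled off alone, a low nonzero digit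
    together with the 0 above it. *)
Lemma nonadjacent_value_lt s : nonadjacent s ->
  (3 * bsd_value s < Posz (2 ^ (size s).+1))%R.
Proof.
have [n] := ubnP (size s); elim: n s => // n IHn [|d s] le_n ns.
  by rewrite bsd_value_nil.
have [d0|/eqP dn0] := eqVneq (dval d) 0%R.
  have := IHn s le_n (nonadjacent_behead ns).
  by rewrite bsd_value_cons d0 size_cons !expnS; lia.
case: s le_n ns => [|c s] le_n ns.
  by rewrite bsd_value_cons bsd_value_nil; case: (dvalP d) => ->.
have c0 : dval c = 0%R by move: ns => /= /andP[/orP[/eqP //|/eqP ->]].
have := IHn s (ltnW le_n) (nonadjacent_behead (nonadjacent_behead ns)).
by rewrite !bsd_value_cons c0 !size_cons !expnS; case: (dvalP d) => ->; lia.
Qed.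

(** The extreme string is 1 0 -1 0 -1 ... from the top. Nonnegativity survives the peeling, since
    the low digits contribute at most 1. *)
Lemma reduced_value_gt s : nonadjacent s -> reduced s -> s != [::] ->
  (0 <= bsd_value s)%R -> (Posz (2 ^ size s) < 3 * bsd_value s)%R.
Proof.
have [n] := ubnP (size s); elim: n s => // n IHn [|d s] // le_n ns rs _.
have rs' := reduced_behead rs.
have [d0|/eqP dn0] := eqVneq (dval d) 0%R.
  have sn0 : s != [::] by case: s rs {le_n ns rs'} => //; rewrite /reduced /= d0.
  have := IHn s le_n (nonadjacent_behead ns) rs' sn0.
  by rewrite bsd_value_cons d0 size_cons !expnS; lia.
case: s le_n ns rs rs' => [|c s] le_n ns rs rs'.
  by rewrite bsd_value_cons bsd_value_nil; case: (dvalP d) dn0 => ->.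
have c0 : dval c = 0%R by move: ns => /= /andP[/orP[/eqP //|/eqP ->]].
have sn0 : s != [::] by case: s rs' {le_n ns rs} => //; rewrite /reduced /= c0.
have := IHn s (ltnW le_n) (nonadjacent_behead (nonadjacent_behead ns))
            (reduced_behead rs') sn0.
by rewrite !bsd_value_cons c0 !size_cons !expnS; case: (dvalP d) => ->; lia.
Qed.

Lemma naf_bitlength_lt n : 3 * n < 2 ^ (naf_bitlength n).+1.
Proof.
have := nonadjacent_value_lt (nonadjacent_naf n).
by rewrite bsd_value_naf -/(naf_bitlength n); lia.
Qed.

Lemma naf_bitlength_gt n : 0 < n -> 2 ^ naf_bitlength n < 3 * n.
Proof.
move=> n_gt0; have := reduced_value_gt (nonadjacent_naf n) (reduced_naf n).
rewrite bsd_value_naf -/(naf_bitlength n).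
have -> : naf n != [::].
  by apply/eqP => nE; have := bsd_value_naf n; rewrite nE bsd_value_nil; lia.
by move=> /(_ isT isT); lia.
Qed.

Lemma naf_bitlength_le n j : 3 * n < 2 ^ j.+1 -> naf_bitlength n <= j.
Proof.
have [->|n_gt0] := posnP n.
  by rewrite /naf_bitlength (@naf_unique 0 [::]) // /is_reduced_naf bsd_value_nil.
move=> /(ltn_trans (naf_bitlength_gt n_gt0)).
by rewrite ltn_exp2l // ltnS.
Qed.

Lemma mem_I_E k n : (n \in I_ k) = (2 ^ k < 3 * n < 2 ^ k.+1).
Proof.
rewrite mem_I_; apply/andP/andP => [[n_gt0 /eqP <-]|[gt_n lt_n]].
  by rewrite naf_bitlength_gt ?naf_bitlength_lt.
have n_gt0 : 0 < n by lia.
rewrite n_gt0 eqn_leq naf_bitlength_le //; split=> //=.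
have := ltn_trans gt_n (naf_bitlength_lt n).
by rewrite ltn_exp2l // ltnS.
Qed.

Lemma expn2_mod3 k : 2 ^ k %% 3 = 1 \/ 2 ^ k %% 3 = 2.
Proof.
by elim: k => [|k IHk]; [left | rewrite expnS; lia].
Qed.

Lemma a_E k : a_ k.+1 = 2 ^ k.+1 %/ 3 + 1.
Proof.
rewrite /a_; case: ex_minnP => m; rewrite mem_I_E => /andP[gt_m lt_m] min_m.
have := min_m (2 ^ k.+1 %/ 3 + 1); rewrite mem_I_E.
by move: gt_m lt_m; rewrite !expnS; have := expn2_mod3 k.+1; rewrite expnS; lia.
Qed.

(** The bounds in [mem_I_E] are symmetric under n -> 2^(k+1) - n, so the largest element is 2^(k+1)
    - a_(k+1). *)
Lemma size_I k : size (I_ k.+1) = (2 ^ k.+1 - 2 * a_ k.+1).+1.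
Proof.
have eI : I_ k.+1 =i iota (a_ k.+1) (2 ^ k.+1 - 2 * a_ k.+1).+1.
  move=> n; rewrite mem_I_E mem_iota a_E.
  have := expn2_mod3 k.+1; have : 0 < 2 ^ k by rewrite expn_gt0.
  by rewrite [2 ^ k.+2]expnS expnS; lia.
rewrite -[RHS](size_iota (a_ k.+1)).
apply: perm_size; apply: uniq_perm; rewrite ?iota_uniq //.
by rewrite filter_uniq ?iota_uniq.
Qed.

(** * Nonadjacent strings for shifted and reflected values *)

Lemma nonadjacent_add_pow2 j s : nonadjacent s -> size s < j ->
  exists t, [/\ nonadjacent t, bsd_value t = (bsd_value s + Posz (2 ^ j))%R
               & weight t = (weight s).+1].
Proof.
(* [size s < j] leaves room for a 0 separating [s] from the 1 at position [j]; [z] counts the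
   further padding zeros. *)
move=> ns lt_s; set z := j - (size s).+1.
exists (s ++ digit_zero :: rcons (nseq z digit_zero) digit_one); split.
- have pz : path (fun d e => (dval d == 0%R) || (dval e == 0%R)) digit_zero
                 (rcons (nseq z digit_zero) digit_one).
    by elim: z => //= z ->.
  clearbody z; rewrite /nonadjacent; case: s ns {lt_s} => [|d s] ns //=.
  by rewrite cat_path; apply/and3P; split; [exact: ns | rewrite orbT | exact: pz].
- rewrite bsd_value_cat bsd_value_cons bsd_value_rcons bsd_value_nseq0 size_nseq.
  have -> : 2 ^ j = 2 ^ size s * (2 * 2 ^ z) by rewrite -expnS -expnD /z; congr (_ ^ _); lia.
  by rewrite ![dval _]/=; lia.
- rewrite /weight count_cat /= -cats1 count_cat count_nseq /=; lia.
Qed.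

(* Negating every digit of the NAF of m except the leading one gives 2^j - m. *)
Lemma nonadjacent_pow2_sub j m : m \in I_ j -> exists s,
  [/\ nonadjacent s, bsd_value s = (Posz (2 ^ j) - Posz m)%R, size s = j
    & weight s = weight (naf m)].
Proof.
rewrite mem_I_ => /andP[m_gt0 /eqP]; rewrite /naf_bitlength.
have := nonadjacent_naf m; have := bsd_value_naf m; have := reduced_naf m.
case/lastP: (naf m) => [|r d]; first by rewrite bsd_value_nil; lia.
rewrite /reduced map_rcons last_rcons size_rcons bsd_value_rcons => dn0 vr nr <-.
(* A leading -1 would outweigh [r] and make the value negative. *)
have d1 : dval d = 1%R.
  case: (dvalP d) dn0 vr => -> // _; have := bsd_value_lt r.
  by rewrite exprz2; lia.
exists (bsd_opp (rcons r (digit_opp d))).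
rewrite nonadjacent_opp size_map size_rcons weight_opp; split=> //.
- move: nr; rewrite /nonadjacent; case: r {vr} => //= e r.
  by rewrite !rcons_path dval_opp oppr_eq0.
- rewrite bsd_value_opp bsd_value_rcons dval_opp d1 expnS.
  by move: vr; rewrite d1; lia.
- by rewrite /weight -!cats1 !count_cat /= dval_opp oppr_eq0.
Qed.

(** * Counting strings by length, value and weight *)

(** Freeing length, value and weight from the NAF allows recursion on the leading digit; [w] is an
    integer so that [w - 1] never truncates. *)
Definition bsd_count (k : nat) (n w : int) : nat :=
  \sum_(t : k.-tuple digit) ((bsd_value t == n) && (Posz (weight t) == w)).

Lemma sum_digit (F : digit -> nat) :
  \sum_d F d = F digit_zero + F digit_one + F digit_mone.
Proof.
rewrite (bigD1 digit_zero) // (bigD1 digit_one) // (bigD1 digit_mone) //=.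
rewrite big1 ?addn0 ?addnA // => d /andP[/andP[]].
by case: (digitP d) => ->; rewrite eqxx.
Qed.

Lemma sum_tuple_rcons k (F : seq digit -> nat) :
  \sum_(t : k.+1.-tuple digit) F t = \sum_(t : k.-tuple digit) \sum_d F (rcons t d).
Proof.
rewrite pair_big /=.
rewrite (reindex (fun p : k.-tuple digit * digit => [tuple of rcons p.1 p.2])) //=.
apply/onW_bij/inj_card_bij.
  move=> [t d] [t' d'] /(congr1 val) /= /rcons_inj [tE ->].
  by congr (_, _); apply: val_inj.
by rewrite card_prod !card_tuple expnSr.
Qed.

Lemma bsd_count_rec k n w : bsd_count k.+1 n w =
  bsd_count k n w + bsd_count k (n - Posz (2 ^ k))%R (w - 1)%R
                  + bsd_count k (n + Posz (2 ^ k))%R (w - 1)%R.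
Proof.
rewrite /bsd_count.
rewrite (sum_tuple_rcons k (fun t => (bsd_value t == n) && (Posz (weight t) == w))).
rewrite -!big_split /=; apply: eq_bigr => t _.
rewrite sum_digit !bsd_value_rcons /weight -!cats1 !count_cat size_tuple /=.
rewrite !addn0 !addn1.
by congr (_ + _ + _); congr (nat_of_bool _); congr (_ && _); lia.
Qed.

Lemma bsd_count_out k n w : (Posz (2 ^ k) <= n)%R -> bsd_count k n w = 0.
Proof.
move=> le_n; rewrite /bsd_count big1 // => t _.
case: eqP => //= vt; have := bsd_value_lt t.
by rewrite exprz2 size_tuple vt; lia.
Qed.

Lemma bsd_count_opp k n w : bsd_count k (- n)%R w = bsd_count k n w.
Proof.
rewrite /bsd_count (reindex (fun t : k.-tuple digit => map_tuple digit_opp t)) /=.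
  apply: eq_bigr => t _.
  by rewrite bsd_value_opp weight_opp eqr_opp.
by apply/onW_bij/inv_bij => t; apply: val_inj; rewrite /= mapK //; exact: digit_oppK.
Qed.

Lemma bsd_count_small k w s : nonadjacent s -> (w < Posz (weight s))%R ->
  bsd_count k (bsd_value s) w = 0.
Proof.
move=> ns lt_w; rewrite /bsd_count big1 // => t _.
case: eqP => //= /esym vt; case: eqP => //= wt.
by have := nonadjacent_weight_min ns vt; lia.
Qed.

(** The lower [k] digits stay below 2^k, so position [k] must hold a 1. *)
Lemma bsd_count_top k n w : (0 <= n)%R ->
  bsd_count k.+1 (n + Posz (2 ^ k))%R (w + 1)%R = bsd_count k n w.
Proof.
by move=> n_ge0; rewrite bsd_count_rec !addrK !(@bsd_count_out k (_ + _)%R) ?addn0; lia.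
Qed.

(** * Computing [M] at any sufficient length *)

Lemma M_count n : M n = bsd_count (naf_bitlength n) (Posz n) (Posz (weight (naf n))).
Proof.
by rewrite /M cardsE -sum1_card /bsd_count [LHS]big_mkcond; apply: eq_bigr => t _.
Qed.

(** At [j] equal to the bitlength, reflecting the NAF keeps its weight; for larger [j], a 1 placed
    above the negated NAF adds one. *)
Lemma pow2_sub_weight_ge j n : naf_bitlength n <= j -> exists s,
  [/\ nonadjacent s, bsd_value s = (Posz (2 ^ j) - Posz n)%R
    & weight (naf n) <= weight s].
Proof.
rewrite leq_eqVlt => /orP[/eqP jE|lt_j].
  (* 0 has bitlength 0 but is not in [I_ 0]; there the string must represent 2^0 = 1. *)
  have [n0|n_gt0] := posnP n.
    exists [:: digit_one]; move: jE; rewrite n0 /naf_bitlength (@naf_unique 0 [::]).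
      by move=> /= <-; rewrite bsd_value_cons bsd_value_nil.
    by rewrite /is_reduced_naf bsd_value_nil.
  have nI : n \in I_ j by rewrite mem_I_ n_gt0 jE /=.
  by have [s [ns vs _ ws]] := nonadjacent_pow2_sub nI; exists s; rewrite ws.
have [|//|t [nt vt wt]] := @nonadjacent_add_pow2 j (bsd_opp (naf n)).
- by rewrite nonadjacent_opp nonadjacent_naf.
- by rewrite size_map.
exists t; rewrite nt vt wt bsd_value_opp bsd_value_naf weight_opp.
by split=> //; lia.
Qed.

(* Extra leading positions never produce new optimal representations: a nonzero
   digit at position j would leave 2^j - n, whose weight is at least that of n. *)
Lemma M_eq_count n j s : nonadjacent s -> bsd_value s = Posz n ->
  3 * n < 2 ^ j.+1 -> M n = bsd_count j (Posz n) (Posz (weight s)).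
Proof.
move=> ns vs /naf_bitlength_le /subnKC <-; rewrite M_count -(weight_naf ns vs).
elim: (j - _) => [|i IHi]; first by rewrite addn0.
rewrite addnS bsd_count_rec -IHi (@bsd_count_out _ (_ + Posz _)%R) ?addn0; last by lia.
have [t [nt vt wt]] := pow2_sub_weight_ge (leq_addr i (naf_bitlength n)).
rewrite -opprB -vt bsd_count_opp bsd_count_small ?addn0 //.
by lia.
Qed.

(** * Splitting on the leading digits *)

(** At position j+1, a 1 leaves m - 2^j, counted through its opposite; a 0 forces a 1 at position j,
    leaving m. Both remainders have the same optimal weight, one less than that of 2^j + m. *)
Lemma M_pow2_add_I j m : m \in I_ j ->
  M (2 ^ j + m) = M (2 ^ j - m) + M m.
Proof.
move=> mI; have [s [ns vs ss ws]] := nonadjacent_pow2_sub mI.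
have := mI; rewrite mem_I_E => /andP[gt_m lt_m].
have lt_pow : m <= 2 ^ j by rewrite expnS in lt_m; lia.
have [|//|t [nt vt wt]] := @nonadjacent_add_pow2 j.+1 (bsd_opp s).
- by rewrite nonadjacent_opp.
- by rewrite size_map ss.
have {}vt : bsd_value t = Posz (2 ^ j + m).
  by rewrite vt bsd_value_opp vs expnS; lia.
have {}vs : bsd_value s = Posz (2 ^ j - m) by rewrite vs; lia.
have [e1 e2] : 2 ^ j.+1 = 2 * 2 ^ j /\ 2 ^ j.+2 = 2 * (2 * 2 ^ j) by rewrite !expnS.
have e3 : 2 ^ j.+3 = 2 * (2 * (2 * 2 ^ j)) by rewrite !expnS.
rewrite (M_eq_count (j := j.+2) nt vt); last by lia.
rewrite (M_eq_count (j := j.+1) ns vs); last by lia.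
rewrite (M_eq_count (nonadjacent_naf m) (bsd_value_naf m) lt_m).
rewrite bsd_count_rec (@bsd_count_out _ (_ + Posz _)%R) ?addn0; last by lia.
rewrite wt weight_opp ws addnC; congr (_ + _).
  rewrite -bsd_count_opp; congr (bsd_count _ _ _); lia.
rewrite -(@bsd_count_top j m) //; congr (bsd_count _ _ _); lia.
Qed.

(** At length j+2 the top digit is forced to be 1, leaving m with its optimal weight. *)
Lemma M_pow2_add j m : 3 * m < 2 ^ j.+1 -> M (2 ^ j.+1 + m) = M m.
Proof.
move=> lt_m; have sm := naf_bitlength_le lt_m.
have [//|t [nt vt wt]] := nonadjacent_add_pow2 (nonadjacent_naf m) (j := j.+1).
rewrite bsd_value_naf in vt.
have {}vt : bsd_value t = Posz (2 ^ j.+1 + m) by rewrite vt; lia.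
rewrite (M_eq_count (j := j.+2) nt vt); last first.
  by rewrite [2 ^ j.+3]expnS [2 ^ j.+2]expnS; lia.
rewrite (M_eq_count (j := j.+1) (nonadjacent_naf m) (bsd_value_naf m)); last first.
  by rewrite expnS; lia.
rewrite -(@bsd_count_top j.+1 m) // wt; congr (bsd_count _ _ _); lia.
Qed.

(** A 1 at position j+1 leaves -p with optimal weight. A 0 there forces a 1 at position j and leaves
    2^j - p, whose NAF is one digit too heavy, so this branch is empty. *)
Lemma M_pow2_sub j p : 3 * p < 2 ^ j -> M (2 ^ j.+1 - p) = M p.
Proof.
case: j => [|j] lt_p.
  (* For [j = 0] the claim becomes [M 2 = M 0]. *)
  have -> : p = 0 by lia.
  by rewrite subn0 -[RHS](@M_pow2_add 0) // addn0.
have sp := naf_bitlength_le lt_p.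
have np : nonadjacent (bsd_opp (naf p)) by rewrite nonadjacent_opp nonadjacent_naf.
have [|t [nt vt wt]] := nonadjacent_add_pow2 np (j := j.+2).
  by rewrite size_map ltnS leqW.
have [|r [nr vr wr]] := nonadjacent_add_pow2 np (j := j.+1).
  by rewrite size_map ltnS.
rewrite bsd_value_opp bsd_value_naf weight_opp in vt wt vr wr.
have [e2 e3] : 2 ^ j.+2 = 2 * 2 ^ j.+1 /\ 2 ^ j.+3 = 2 * (2 * 2 ^ j.+1) by rewrite !expnS.
have e4 : 2 ^ j.+4 = 2 * 2 ^ j.+3 by rewrite expnS.
have {}vt : bsd_value t = Posz (2 ^ j.+2 - p) by rewrite vt; lia.
rewrite (M_eq_count (j := j.+3) nt vt); last by lia.
rewrite (M_eq_count (j := j.+2) (nonadjacent_naf p) (bsd_value_naf p)); last by lia.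
rewrite bsd_count_rec (@bsd_count_out _ (_ + Posz _)%R) ?addn0; last by lia.
have -> : Posz (2 ^ j.+2 - p) = (bsd_value r + Posz (2 ^ j.+1))%R by rewrite vr; lia.
have -> : Posz (weight t) = (Posz (weight (naf p)) + 1)%R by rewrite wt; lia.
rewrite bsd_count_top; last by rewrite vr; lia.
rewrite (bsd_count_small _ nr) ?add0n; last by rewrite wr; lia.
by rewrite -bsd_count_opp vr; congr (bsd_count _ _ _); lia.
Qed.

Theorem mainTheorem5 (k v u : nat) (hk : 3 <= k) (hv : v < size (I_ (k - 2)))
    (hu : b_ k + u <= 2 ^ (k - 1)) :
  [/\ M (a_ k + v) = M (2 ^ (k - 2) - (a_ (k - 2) + v)) + M (a_ (k - 2) + v),
      M (b_ k + u) = M (2 ^ (k - 1) - (a_ (k - 1) + u)),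
      M (2 ^ k - (b_ k + u)) = M (2 ^ (k - 1) - (a_ (k - 1) + u))
    & M (c_ k + v) = M (a_ (k - 2) + v)].
Proof.
case: k hk hv hu => [|[|[|j]]] // _.
rewrite /c_ /b_ !subSS !subn0 !size_I !a_E.
have [e2 e3] : 2 ^ j.+2 = 2 * 2 ^ j.+1 /\ 2 ^ j.+3 = 2 * (2 * 2 ^ j.+1) by rewrite !expnS.
have := expn2_mod3 j.+1; have : 0 < 2 ^ j by rewrite expn_gt0.
have e1 : 2 ^ j.+1 = 2 * 2 ^ j by rewrite expnS.
move=> pow_gt0 mod3 hv hu.
set m := 2 ^ j.+1 %/ 3 + 1 + v.
have mI : m \in I_ j.+1 by rewrite mem_I_E e2 /m; lia.
have lt_m : 3 * m < 2 ^ j.+2 by move: mI; rewrite mem_I_E => /andP[].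
set b := 2 ^ j.+3 %/ 3 + 1 + _ in hu *.
pose p := 2 ^ j.+2 - (b + u).
(* With k = j+3, b_k = 2^(k-1) - a_(k-2) + 1, so p <= a_(k-2) - 1 < 2^(k-2)/3, strictly because 3
   does not divide 2^(k-2). *)
have lt_p : 3 * p < 2 ^ j.+1 by rewrite /p /b; lia.
have pE : p + (b + u) = 2 ^ j.+2 by rewrite /p; lia.
have -> : 2 ^ j.+3 %/ 3 + 1 + v = 2 ^ j.+1 + m by rewrite /m; lia.
have -> : b + (2 ^ j.+2 - 2 * (2 ^ j.+2 %/ 3 + 1)).+1 + v = 2 ^ j.+2 + m.
  by rewrite /b /m; lia.
(* This amounts to b_k = 2^(k-2) + a_(k-1). *)
have -> : 2 ^ j.+2 - (2 ^ j.+2 %/ 3 + 1 + u) = 2 ^ j.+1 + p.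
  by move: pE; rewrite /b; lia.
have -> : 2 ^ j.+3 - (b + u) = 2 ^ j.+2 + p by lia.
have -> : b + u = 2 ^ j.+2 - p by lia.
split.
- exact: M_pow2_add_I.
(* Both sides of this identity and of the next equal [M p]. *)
- by rewrite M_pow2_sub // M_pow2_add.
- by rewrite !M_pow2_add // e2; lia.
- exact: M_pow2_add.
Qed.
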